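(* Let $X$ be a non-trivial real Hausdorff locally convex space with topological dual $X^*$ and let $C\subset X$. Then $N_C$ is maximal monotone (or $C=C^{\#}$) if and only if for every $x\in X\setminus C$ there is $n^*\in D(\partial\sigma_C)=R(N_C)$ such that $\langle x,n^*\rangle>\sigma_C(n^* )$.
   Context: $\langle x,x^*\rangle:=x^*(x)$ for $x\in X$, $x^*\in X^*$; $X^*$ carries the weak-star topology and its dual is identified with $X$. For $T:X\rightrightarrows X^*$, $\operatorname{Graph}T=\{(x,x^* )\in X\times X^*\mid x^*\in T(x)\}$, and $R(T)=\bigcup_{x\in X}T(x)$ is its range. $T$ is monotone if $\langle x_1-x_2,x_1^*-x_2^*\rangle\ge 0$ for all $(x_1,x_1^* ),(x_2,x_2^* )\in\operatorname{Graph}T$, and maximal monotone if it is monotone and its graph is not properly contained in the graph of another monotone operator from $X$ to $X^*$. For $C\subset X$: the normal cone $N_C:X\rightrightarrows X^*$ is $N_C(a)=\{a^*\in X^*\mid \langle y-a,a^*\rangle\le 0\ \forall y\in C\}$ if $a\in C$ and $N_C(a)=\emptyset$ if $a\notin C$; the support function is $\sigma_C(x^* )=\sup\{\langle x,x^*\rangle\mid x\in C\}$, $x^*\in X^*$, with $\sup\emptyset=-\infty$; the portable hull is $C^{\#}:=\{x\in X\mid \forall (a,a^* )\in\operatorname{Graph}N_C,\ \langle x-a,a^*\rangle\le 0\}$. The subdifferential $\partial\sigma_C:X^*\rightrightarrows X$ is taken with respect to the dual system $(X^*,X)$: $x\in\partial\sigma_C(n^* )$ iff $\sigma_C(n^*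 )$ is finite and $\sigma_C(y^* )\ge\sigma_C(n^* )+\langle x,y^*-n^*\rangle$ for all $y^*\in X^*$; its domain is $D(\partial\sigma_C)=\{n^*\in X^*\mid\partial\sigma_C(n^* )\ne\emptyset\}$. *)

(* Defs.v *)
From HB Require Import structures.
From mathcomp Require Import all_boot all_order all_algebra.
From mathcomp Require Import all_classical all_reals all_analysis.

Set Implicit Arguments.
Unset Strict Implicit.
Unset Printing Implicit Defensive.

Import Order.TTheory GRing.Theory Num.Theory.
Import numFieldNormedType.Exports.

Local Open Scope classical_set_scope.
Local Open Scope ring_scope.

(* The interface tvsType includes local convexity, but not separation.
   The dual is not given a topology: it enters only through the pairing. *)
Section dual.
Context (R : realType) (X : tvsType R).

Definition continuous_linear : {pred (X -> R^o)} :=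
  fun f => `[< linear f /\ continuous f >].

Record dual := Dual {
  dual_fun :> X -> R^o ;
  dual_funP : dual_fun \in continuous_linear }.

Lemma continuous_linear_submod_closed : submod_closed continuous_linear.
Proof.
split => [|a f g].
  by apply/asboolP; split => [b x y|]; [rewrite scaler0 addr0|exact: cst_continuous].
move=> /asboolP[lf cf] /asboolP[lg cg]; apply/asboolP; split => [b x y|x].
  rewrite /= !fctE lf lg !scalerDr addrACA !scalerA.
  by rewrite [a * b]mulrC.
apply: (@cvgD _ R^o) => //; last exact: cg.
by apply: (@cvgZr _ R^o); exact: cf.
Qed.

HB.instance Definition _ :=
  GRing.isSubmodClosed.Build R (X -> R^o) continuous_linear
    continuous_linear_submod_closed.

HB.instance Definition _ := [isSub for dual_fun].
HB.instance Definition _ := [Choice of dual by <:].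
HB.instance Definition _ := [SubChoice_isSubLmodule of dual by <:].

End dual.

Section operators.
Context (R : realType) (X : tvsType R).
Implicit Types (C : set X) (T : X -> set (dual X)).

Definition pairing (x : X) (x' : dual X) : R := x' x.

Definition graph T : set (X * dual X) := [set p | T p.1 p.2].

Definition op_range T : set (dual X) := [set x' | exists x, T x x'].

Definition monotone_op T : Prop :=
  forall p q, graph T p -> graph T q -> 0 <= pairing (p.1 - q.1) (p.2 - q.2).

Definition maximal_monotone T : Prop :=
  monotone_op T /\ forall S, monotone_op S -> ~ (graph T `<` graph S).

Definition normal_cone C : X -> set (dual X) :=
  fun a => [set a' | C a /\ forall y, C y -> pairing (y - a) a' <= 0].

Definition support_fun C (x' : dual X) : \bar R :=
  ereal_sup [set (pairing x x')%:E | x in C].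

Definition portable_hull C : set X :=
  [set x | forall p, graph (normal_cone C) p -> pairing (x - p.1) p.2 <= 0].

(* The subdifferential is taken in the dual system (dual X, X), so that
   subgradients are points of X. *)
Definition subdiff (f : dual X -> \bar R) : dual X -> set X :=
  fun n' => [set x | f n' \is a fin_num /\
    forall y', (f n' + (pairing x (y' - n'))%:E <= f y')%E].

Definition subdiff_dom (f : dual X -> \bar R) : set (dual X) :=
  [set n' | subdiff f n' !=set0].

Definition separated_by (N : set (dual X)) C : Prop :=
  forall x, ~ C x ->
    exists2 n', N n' & (support_fun C n' < (pairing x n')%:E)%E.

End operators.

Arguments pairing {R X} x x' : simpl never.

(* Main.v *)
Require Import Defs.
From HB Require Import structures.
From mathcomp Require Import all_boot all_order all_algebra.
From mathcomp Require Import ring.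
From mathcomp Require Import all_classical all_reals all_analysis.

Set Implicit Arguments.
Unset Strict Implicit.
Unset Printing Implicit Defensive.

Import Order.TTheory GRing.Theory Num.Theory.
Import numFieldNormedType.Exports.

Local Open Scope classical_set_scope.
Local Open Scope ring_scope.

(** Write [s] for the support function of [C] and [<x, x'>] for the pairing.
    Normals and subgradients are both points of contact between [s] and an
    evaluation functional: [a'] is normal to [C] at [a] iff [a] lies in [C] and
    [s a' = <a, a'>] ([normal_coneE]), whereas [x] is a subgradient of [s] at
    [n'] iff [<x, y'> <= s y'] for all [y'], with equality at [n']
    ([subdiff_supportE]; sublinearity of [s] gives the equality).  A point of
    [C] always satisfies the inequality, so the range of the normal cone is
    contained in the domain of the subdifferential.  Conversely, a subgradient
    of [s] cannot be strictly separated from [C] by any functional at all, so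
    it lies in [C] if some family of functionals separates [C] from all other
    points.  Hence, under the separation property, the domain and the range are
    equal, and the two separation properties are equivalent
    ([range_normal_cone_sub_dom], [subdiff_dom_sub_range]).

    Since [s a' = <a, a'>] for a normal [a'] at [a], the inequality
    [<x - a, a'> > 0] that excludes [x] from the portable hull is the strict
    separation [s a' < <x, a'>]; so [C] is portable iff the range of its normal
    cone separates ([portable_separated]).

    Finally, maximality means that every pair monotonically related to the
    graph belongs to it ([maximal_monotoneP]).  A point [x] is in the portable
    hull exactly when the pair [(x, 0)] is related to the normal cone, so
    maximality puts [x] in [C].  For the converse, let [(x, x')] be related to
    the normal cone.  Because the values of the normal cone are cones, letting
    the scale of [a'] tend to infinity in [<x - a, x' - a'> >= 0] puts [x] in
    the portable hull, which is [C]; taking [a' = 0] then says that [x'] is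
    normal at [x] ([maximal_monotone_portable]). *)

(** * The pairing *)

Section pairing.
Context (R : realType) (X : tvsType R).
Implicit Types (x y : X).

Lemma pairingBl x y (x' : dual X) : pairing (x - y) x' = pairing x x' - pairing y x'.
Proof.
have /asboolP[lx' _] := dual_funP x'.
by rewrite /pairing addrC -scaleN1r lx' scaleN1r addrC.
Qed.

Lemma pairing0r x : pairing x 0 = 0. Proof. by []. Qed.

Lemma pairingBr x (x' y' : dual X) : pairing x (x' - y') = pairing x x' - pairing x y'.
Proof. by []. Qed.

Lemma pairingZr x (k : R) (x' : dual X) : pairing x (k *: x') = k * pairing x x'.
Proof. by []. Qed.

End pairing.

(** * The support function, normals and subgradients *)

Section support.
Context (R : realType) (X : tvsType R).
Implicit Types (C : set X) (x a : X).

Lemma support_fun_ge C x (x' : dual X) : C x -> ((pairing x x')%:E <= support_fun C x')%E.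
Proof. by move=> Cx; apply: ereal_sup_ubound; exists x. Qed.

Lemma support_fun0 C : C !=set0 -> support_fun C 0 = 0%E.
Proof.
move=> [c Cc]; apply/le_anti/andP; split; last exact: (support_fun_ge 0 Cc).
by apply: ge_ereal_sup => _ [y _ <-]; rewrite pairing0r.
Qed.

Lemma support_fun_scale2 C (x' : dual X) :
  (support_fun C (2 *: x') <= 2%:E * support_fun C x')%E.
Proof.
apply: ge_ereal_sup => _ [y Cy <-].
by rewrite pairingZr EFinM lee_pmul2l// support_fun_ge.
Qed.

Lemma normal_coneE C a (a' : dual X) :
  normal_cone C a a' <-> C a /\ support_fun C a' = (pairing a a')%:E.
Proof.
split=> -[Ca Na]; split=> //.
  apply/le_anti/andP; split; last exact: support_fun_ge.
  apply: ge_ereal_sup => _ [y Cy <-].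
  by rewrite lee_fin -subr_le0 -pairingBl Na.
by move=> y Cy; rewrite pairingBl subr_le0 -lee_fin -Na support_fun_ge.
Qed.

(** The equality [s n' = <x, n'>] comes from testing the subgradient inequality
    at [0], where [s] vanishes, and at [2 *: n'], where it is at most doubled;
    it turns that inequality into a bound in which [n'] no longer occurs. *)
Lemma subdiff_supportE C (n' : dual X) x :
  subdiff (support_fun C) n' x <->
  support_fun C n' = (pairing x n')%:E /\
  forall y' : dual X, ((pairing x y')%:E <= support_fun C y')%E.
Proof.
split=> [[fin_n sub_n]|[sE s_ge]]; last first.
  by rewrite /subdiff /= sE; split=> // y'; rewrite -EFinD pairingBr addrC subrK.
have C0 : C !=set0.
  (* the supremum over the empty set is -oo *)
  apply/set0P/eqP => C0; move: fin_n.
  by rewrite /support_fun C0 image_set0 ereal_sup0.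
have [r sE] : exists r, support_fun C n' = r%:E.
  by exists (fine (support_fun C n')); rewrite fineK.
have rE : r = pairing x n'.
  apply/le_anti/andP; split.
    have := sub_n 0; rewrite support_fun0// sE -EFinD lee_fin.
    by rewrite pairingBr pairing0r sub0r subr_le0.
  have := le_trans (sub_n (2 *: n')) (support_fun_scale2 C n').
  rewrite sE -EFinD -EFinM lee_fin pairingBr pairingZr !mulr_natl !mulr2n.
  by rewrite addrK lerD2l.
split=> [|y']; first by rewrite sE rE.
by have := sub_n y'; rewrite sE rE -EFinD pairingBr addrC subrK.
Qed.

Lemma range_normal_cone_sub_dom C :
  op_range (normal_cone C) `<=` subdiff_dom (support_fun C).
Proof.
move=> n' [a /normal_coneE[Ca sE]]; exists a.
by apply/subdiff_supportE; split=> // y'; exact: support_fun_ge.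
Qed.

Lemma separated_by_subset (N M : set (dual X)) C :
  N `<=` M -> separated_by N C -> separated_by M C.
Proof. by move=> NM sepN x /sepN[n' /NM Mn' ltn]; exists n'. Qed.

(** The evaluation at a subgradient is dominated by the support function on
    the whole dual, so no functional strictly separates that point from [C]. *)
Lemma subdiff_dom_sub_range (N : set (dual X)) C :
  separated_by N C ->
  subdiff_dom (support_fun C) `<=` op_range (normal_cone C).
Proof.
move=> sepC n' [x /subdiff_supportE[sE s_ge]]; exists x.
apply/normal_coneE; split=> //; apply: contrapT => /sepC[y' _].
by rewrite ltNge s_ge.
Qed.

Lemma sub_portable_hull C : C `<=` portable_hull C.
Proof. by move=> x Cx [a a'] [_ Na]; exact: Na. Qed.

Lemma portable_separated C :
  C = portable_hull C <-> separated_by (op_range (normal_cone C)) C.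
Proof.
split=> [CE x|sepC].
  rewrite [X in ~ X -> _](congr1 (fun A : set X => A x) CE).
  move=> /existsNP[[a a']] /not_implyP[/= Na /negP]; rewrite -ltNge => lt_a.
  exists a'; first by exists a.
  have /normal_coneE[_ ->] := Na.
  by rewrite lte_fin -subr_gt0 -pairingBl.
apply/seteqP; split; first exact: sub_portable_hull.
move=> x hullx; apply: contrapT => /sepC[a' [a Na]].
have /normal_coneE[_ ->] := Na.
by rewrite lte_fin ltNge -subr_le0 -pairingBl (hullx (a, a')).
Qed.

End support.

(** * Maximal monotonicity *)

Section monotone.
Context (R : realType) (X : tvsType R).
Implicit Types (C : set X) (T : X -> set (dual X)) (p q : X * dual X).

Lemma pairingBBC p q :
  pairing (p.1 - q.1) (p.2 - q.2) = pairing (q.1 - p.1) (q.2 - p.2).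
Proof. by rewrite !pairingBr !pairingBl; ring. Qed.

(** A monotonically related pair outside the graph could be added to it. *)
Lemma maximal_monotoneP T :
  maximal_monotone T <->
  monotone_op T /\
  forall p, (forall q, graph T q -> 0 <= pairing (p.1 - q.1) (p.2 - q.2)) ->
    graph T p.
Proof.
split=> -[monoT maxT]; split=> //.
  move=> p relp; apply: contrapT => NTp.
  pose S x := [set x' | T x x' \/ (x, x') = p].
  have SP q : graph S q -> graph T q \/ q = p by case: q.
  apply: (maxT S); last first.
    split=> [q Tq|ST]; first by left.
    by apply/NTp/ST; right; case: (p).
  move=> q r /SP[Tq|->] /SP[Tr|->].
  - exact: monoT.
  - by rewrite pairingBBC; exact: relp.
  - exact: relp.
  - by rewrite pairingBl subrr.
move=> S monoS [TS]; apply => p Sp.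
by apply: maxT => q /TS Sq; exact: monoS.
Qed.

Lemma normal_cone_monotone C : monotone_op (normal_cone C).
Proof.
move=> [a a'] [b b'] [/= Ca Na] [/= Cb Nb].
rewrite /= pairingBr subr_ge0; apply: le_trans (Nb _ Ca) _.
by have := Na _ Cb; rewrite !pairingBl subr_le0 subr_ge0.
Qed.

Lemma normal_coneZ C a (a' : dual X) (k : R) :
  0 <= k -> normal_cone C a a' -> normal_cone C a (k *: a').
Proof.
move=> k0 [Ca Na]; split=> // y Cy.
by rewrite pairingZr mulr_ge0_le0// Na.
Qed.

Lemma normal_cone0 C a : C a -> normal_cone C a 0.
Proof. by move=> Ca; split=> // y _; rewrite pairing0r. Qed.

Lemma maximal_monotone_portable C :
  maximal_monotone (normal_cone C) <-> C = portable_hull C.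
Proof.
split=> [/maximal_monotoneP[_ maxN]|CE].
  apply/seteqP; split; first exact: sub_portable_hull.
  move=> x hullx; suff [] : normal_cone C x 0 by [].
  apply: (maxN (x, 0)) => q Nq /=.
  by rewrite pairingBr pairing0r sub0r oppr_ge0 hullx.
apply/maximal_monotoneP; split; first exact: normal_cone_monotone.
move=> [x x'] relx.
have Cx : C x.
  rewrite CE => -[a a'] Na /=; rewrite leNgt; apply/negP => gt0.
  (* at this scale, <x - a, k *: a'> = |<x - a, x'>| + 1 exceeds <x - a, x'> *)
  pose k := (`|pairing (x - a) x'| + 1) / pairing (x - a) a'.
  have k0 : 0 <= k by rewrite divr_ge0 ?ltW// ltr_wpDl.
  have := relx (a, k *: a') (normal_coneZ k0 Na).
  rewrite /= pairingBr pairingZr subr_ge0 divfK ?gt_eqF//.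
  by rewrite leNgt ltr_pwDr// ler_norm.
split=> //= y Cy.
have := relx (y, 0) (normal_cone0 Cy).
by rewrite /= subr0 !pairingBl subr_ge0 subr_le0.
Qed.

End monotone.

Theorem theorem3 (R : realType) (X : tvsType R)
    (hausX : hausdorff_space X) (ntX : exists x : X, x != 0) (C : set X) :
  let D := subdiff_dom (support_fun C) in
  let RN := op_range (normal_cone C) in
  [/\ maximal_monotone (normal_cone C) <-> separated_by D C,
      C = portable_hull C <-> separated_by D C,
      separated_by D C <-> separated_by RN C
    & separated_by D C -> D = RN].
Proof.
move=> D RN.
have DE : separated_by D C -> D = RN.
  move=> sepD; apply/seteqP; split; last exact: range_normal_cone_sub_dom.
  exact: subdiff_dom_sub_range sepD.
have sepE : separated_by D C <-> separated_by RN C.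
  split=> [sepD|]; first by rewrite -DE.
  exact/separated_by_subset/range_normal_cone_sub_dom.
have portE : C = portable_hull C <-> separated_by D C.
  exact: iff_trans (portable_separated C) (iff_sym sepE).
by split=> //; exact: iff_trans (maximal_monotone_portable C) portE.
Qed.
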